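(* Let $\ell$ be an odd prime and $p$ a prime with $\ell \mid p-1$. Suppose $a\in \mathbb{F}_p\setminus\{0,1\}$ satisfies $a^{(p-1)/\ell}=1$ and $(1-a)^{(p-1)/\ell}=1$ in $\mathbb{F}_p$. Then the prime $(t-a)$ of $\mathbb{F}_p[t]$ is totally decomposed (splits into $\ell^3$ distinct primes) in $\mathcal{R}^{(\ell)}$ if and only if $A_\ell(a)=1$.
   Context: Fix a primitive $\ell$-th root of unity $\zeta_\ell\in\mathbb{F}_p$ and let $t$ be transcendental over $\mathbb{F}_p$. Let $\mathcal{K}^{(\ell)}=\mathbb{F}_p(t)(t^{1/\ell},(1-t)^{1/\ell})$, let $\epsilon_\ell(t)=\prod_{i=1}^{\ell-1}(1-\zeta_\ell^i t^{1/\ell})^i\in\mathcal{K}^{(\ell)}$, and let $\mathcal{R}^{(\ell)}=\mathcal{K}^{(\ell)}(\epsilon_\ell(t)^{1/\ell})$; this is a Galois extension of $\mathbb{F}_p(t)$ of degree $\ell^3$ with group isomorphic to the mod $\ell$ Heisenberg group of upper unitriangular $3\times 3$ matrices over $\mathbb{F}_\ell$, unramified outside $\{0,1,\infty\}$. Primes of $\mathcal{R}^{(\ell)}$ above $(t-a)$ mean primes of the integral closure of $\mathbb{F}_p[t]$ in $\mathcal{R}^{(\ell)}$. For $0\le j\le \ell-1$ put $\epsilon_{\ell,j}(x)=\prod_{i=1}^{\ell-1}(1-\zeta_\ell^{i+j}x^{1/\ell})^i$, a polynomial in $x^{1/\ell}$, and $A_\ell(x)=\frac{1}{\ell}\sum_{j=0}^{\ell-1}\epsilon_{\ell,j}(x)^{(p-1)/\ell}$;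 this is invariant under $x^{1/\ell}\mapsto\zeta_\ell x^{1/\ell}$ and hence a polynomial in $x$ with coefficients in $\mathbb{F}_p$, which is evaluated at $x=a$. *)

(* Defs.v *)
From HB Require Import structures.
From mathcomp Require Import all_boot all_order all_algebra all_field.
From mathcomp Require Import boolp classical_sets functions cardinality.

Set Implicit Arguments.
Unset Strict Implicit.
Unset Printing Implicit Defensive.

Import GRing.Theory.
Local Open Scope ring_scope.

(* With z = zeta_l and y = x^(1/l), this is epsilon_{l,j}(x); j = 0 gives
   epsilon_l(x). *)
Definition eps (R : comNzRingType) (l : nat) (z : R) (j : nat) (y : R) : R :=
  \prod_(1 <= i < l) (1 - z ^+ (i + j) * y) ^+ i.

Lemma eps_shift (R : comNzRingType) (l : nat) (z : R) (j : nat) (y : R) :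
  eps l z j y = eps l z 0 (z ^+ j * y).
Proof. by apply: eq_bigr => i _; rewrite addn0 exprD mulrA. Qed.

Lemma rmorph_eps (R S : comNzRingType) (f : {rmorphism R -> S}) (l : nat)
    (z : R) (j : nat) (y : R) : f (eps l z j y) = eps l (f z) j (f y).
Proof.
rewrite rmorph_prod; apply: eq_bigr => i _.
by rewrite rmorphXn rmorphB rmorph1 rmorphM rmorphXn.
Qed.

Lemma coef_comp_polyZX (R : comNzRingType) (q : {poly R}) (z : R) n :
  (q \Po (z *: 'X))`_n = z ^+ n * q`_n.
Proof.
rewrite comp_polyE coef_sum.
under eq_bigr => i _ do rewrite exprZn !coefZ coefXn.
case: (ltnP n (size q)) => [ltn|len].
  rewrite (bigD1 (Ordinal ltn)) //= eqxx mulr1 mulrC big1 ?addr0 // => i ne.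
  by rewrite eq_sym (negbTE (ne : (i : nat) != n)) !mulr0.
rewrite (nth_default 0 len) mulr0 big1 // => i _.
by rewrite gtn_eqF ?mulr0 // (leq_trans (ltn_ord i)).
Qed.

Section APoly.
Variables (F : fieldType) (l p : nat) (z : F).

(* A_l(x) as a polynomial in 'X = x^(1/l). *)
Definition A_root : {poly F} :=
  l%:R^-1 *: \sum_(0 <= j < l) eps l z%:P j 'X ^+ (p.-1 %/ l).

(* A_l(x) as a polynomial in 'X = x: only the exponents divisible by l
   contribute to A_root, see A_polyE. *)
Definition A_poly : {poly F} := \poly_(i < size A_root) A_root`_(i * l).

Lemma A_root_invar : l.-primitive_root z -> A_root \Po (z *: 'X) = A_root.
Proof.
move=> z_prim; rewrite /A_root linearZ /=; congr (_ *: _).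
have [l' El] : exists l', l = l'.+1.
  by case: l z_prim => [/prim_order_gt0|l' _] //; exists l'.
pose g j := eps l z%:P j 'X ^+ (p.-1 %/ l).
have gS j : g j \Po (z *: 'X) = g j.+1.
  rewrite rmorphXn /g /= (rmorph_eps (comp_poly (z *: 'X))) /= comp_polyC.
  rewrite comp_polyX eps_shift [in RHS]eps_shift -mul_polyC mulrA exprSr //.
rewrite rmorph_sum /= (eq_bigr _ (fun j _ => gS j)).
rewrite -[RHS]/(\sum_(0 <= j < l) g j) El big_nat_recr //=.
rewrite [RHS]big_nat_recl //= addrC; congr (_ + _).
rewrite -El /g eps_shift [in RHS]eps_shift -!polyC_exp (prim_expr_order z_prim).
by rewrite expr0.
Qed.

Lemma A_polyE : l.-primitive_root z -> A_poly \Po 'X^l = A_root.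
Proof.
move=> z_prim; have l_gt0 := prim_order_gt0 z_prim.
apply/polyP => n; rewrite coef_comp_poly_Xn // /A_poly coef_poly.
have [dvd_ln|ndvd_ln] := boolP (l %| n)%N.
  rewrite divnK //; case: ltnP => // le_n.
  by rewrite nth_default // (leq_trans le_n) ?leq_div.
have := congr1 (fun q : {poly F} => q`_n) (A_root_invar z_prim).
rewrite coef_comp_polyZX.
move/eqP; rewrite -subr_eq0 -{2}[A_root`_n]mul1r -mulrBl mulf_eq0 subr_eq0.
by rewrite -(prim_order_dvd z_prim) (negbTE ndvd_ln) => /eqP ->.
Qed.

End APoly.

Section IntegralClosure.
Variables (B : comNzRingType) (K : fieldType) (f : {rmorphism B -> K}).

Definition intcl_pred : {pred K} := fun x => `[< integralOver f x >].

Fact intcl_pred_subring : subring_closed intcl_pred.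
Proof.
split=> [|x y /asboolP ix /asboolP iy|x y /asboolP ix /asboolP iy];
  apply/asboolP; [exact: integral1|exact: integral_sub|exact: integral_mul].
Qed.
HB.instance Definition _ :=
  GRing.isSubringClosed.Build K intcl_pred intcl_pred_subring.

Definition intcl := {x : K | x \in intcl_pred}.
HB.instance Definition _ := SubChoice.on intcl.
HB.instance Definition _ :=
  [SubChoice_isSubComNzRing of intcl by <:].

Fact intcl_of_subproof (b : B) : f b \in intcl_pred.
Proof. exact/asboolP/integral_id. Qed.

Definition intcl_of (b : B) : intcl := Sub (f b) (intcl_of_subproof b).

(* Prime ideals of intcl whose contraction to B is the principal ideal (b);
   idealr_closed includes properness. Predicates are bool-valued, hence two of
   them are equal iff they have the same elements (functional extensionality). *)
Definition primes_above (b : B) : set (intcl -> bool) :=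
  [set P : intcl -> bool | [/\ idealr_closed P, prime_idealr_closed P
     & forall c : B, intcl_of c \in P <-> exists d, c = d * b]]%classic.

End IntegralClosure.

Arguments primes_above {B K} f b.

Section RationalFunctions.
Variables (F : fieldType) (L : fieldExtType {fraction {poly F}}).

Definition poly_emb : {rmorphism {poly F} -> L} := in_alg L \o @tofrac {poly F}.

End RationalFunctions.

(* Main.v *)
Require Import Defs.
From HB Require Import structures.
From mathcomp Require Import all_boot all_order all_algebra all_field.
From mathcomp Require Import boolp classical_sets functions cardinality.
From mathcomp Require Import generic_quotient ring.

Set Implicit Arguments.
Unset Strict Implicit.
Unset Printing Implicit Defensive.

Import GRing.Theory.
Local Open Scope ring_scope.

(* Write F for F_p, g for eps_l as a polynomial in u = t^(1/l), and a = b^l,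
   1 - a = d^l. The values of g at the points z^i b all have the same power of
   exponent (p-1)/l, because g(z y) / g(y) = (1 - y)^l / (1 - y^l) and 1 - a is an
   l-th power; this common power is A_l(a). So A_l(a) = 1 iff g(z^i b) is an l-th
   power in F, for one or equivalently for all i.

   A prime P above t - a contains u - z^i b and v - z^j d for some i, j, and
   w^l = g(z^i b) modulo P. The trace of P on F[u, v, w] determines P: it is
   locally generated by t - a, since (u - b) s = t - a with s = l b^(l-1) modulo P
   and likewise for v and w, so the localisation of F[u, v, w] at P is already
   integrally closed. If g(z^i b) is not an l-th power then X^l - g(z^i b) is
   irreducible and (i, j) determines the trace, which leaves at most l^2 primes.
   Otherwise the traces are the kernels of the evaluations of F[u, v, w] at points
   (z^i b, z^j d, z^k c_i). These l^3 evaluations exist because the powers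
   v^j w^k (j, k < l) are linearly independent over F(u): by Kummer theory it is
   enough that 1 - u^l and g(u) (1 - u^l)^k are not l-th powers in F(u), which is
   read off from the multiplicities at 1 and z^-1. *)

(** * Kummer theory in prime degree *)

(* The determinant of multiplication by X on F[X]/(g), where X^l = e. *)
Lemma dvdp_Xn_sub_coef0 (F : fieldType) (g : {poly F}) (l : nat) (e : F) :
  g \is monic -> g %| 'X^l - e%:P ->
  ((-1) ^+ (size g).-1 * g`_0) ^+ l = e ^+ (size g).-1.
Proof.
move=> g_monic /dvdpP[q defX].
have [d_eq0|d_gt0] := posnP (size g).-1.
  have /size1_polyC gC : (size g <= 1)%N by rewrite -subn_eq0 subn1 d_eq0.
  move: g_monic; rewrite d_eq0 monicE gC lead_coefC coefC => /= /eqP ->.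
  by rewrite !expr0 mulr1 expr1n.
move: (companionmx g) (companionmxK g_monic); rewrite -(prednK d_gt0).
set n := _.-1.-1 => M charM; rewrite -charM char_poly_det mulrA -exprMn.
rewrite mulrNN mulr1 expr1n mul1r.
suff /(congr1 determinant): M ^+ l = e%:M.
  by rewrite det_scalar => <-; elim: l {defX} => [|l IHl];
    rewrite ?expr0 ?det1 // !exprS det_mulmx IHl.
apply/eqP; rewrite -subr_eq0; apply/eqP.
transitivity (horner_mx M ('X^l - e%:P)).
  by rewrite rmorphB rmorphXn /= horner_mx_X horner_mx_C.
by rewrite defX rmorphM /= -[in horner_mx M g]charM Cayley_Hamilton mulr0.
Qed.

(** Let n be the signed constant coefficient of a monic proper factor of degree d, so that n^l =
    e^d. Since d is prime to l, Bezout coefficients with a d = b l + 1 make n^a / e^b an l-th root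
    of e. *)
Lemma irreducible_Xn_sub (F : fieldType) (l : nat) (e : F) :
  prime l -> (forall x, x ^+ l != e) -> irreducible_poly ('X^l - e%:P).
Proof.
move=> l_pr e_nroot; have l_gt0 := prime_gt0 l_pr.
have nz_e : e != 0 by have := e_nroot 0; rewrite expr0n gtn_eqF //= eq_sym.
split=> [|q q_size q_dvd]; first by rewrite size_XnsubC // ltnS.
have nz_X : 'X^l - e%:P != 0 by rewrite -size_poly_gt0 size_XnsubC.
have nz_q : q != 0 by apply: contraNneq nz_X => q0; rewrite q0 dvd0p in q_dvd.
have nz_lq : lead_coef q != 0 by rewrite lead_coef_eq0.
pose g := (lead_coef q)^-1 *: q.
have size_g : size g = size q by rewrite size_scale ?invr_eq0.
have g_monic : g \is monic by rewrite monicE lead_coefZ mulVf.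
have g_dvd : g %| 'X^l - e%:P by rewrite dvdpZl ?invr_eq0.
rewrite -dvdp_size_eqp // eqn_leq dvdp_leq //= size_XnsubC // leqNgt.
apply/negP => lt_size.
have d_gt0 : (0 < (size g).-1)%N.
  rewrite size_g; move: q_size nz_q lt_size; rewrite -size_poly_gt0.
  by case: (size q) => [|[]].
have co_dl : coprime (size g).-1 l.
  rewrite coprime_sym prime_coprime // gtnNdvd // size_g.
  by rewrite -ltnS prednK ?size_poly_gt0.
have := dvdp_Xn_sub_coef0 g_monic g_dvd; set n := _ * _; set d := (size g).-1.
case: (egcdnP l d_gt0) => a b def_g _ nl.
have /eqP := e_nroot (n ^+ a / e ^+ b); apply.
rewrite exprMn exprVn -!exprM mulnC exprM nl -exprM [(d * a)%N]mulnC def_g.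
rewrite (eqP co_dl) exprD expr1 mulrC mulKf ?expf_neq0 //.
Qed.

Section Kummer.
Variables (K : fieldType) (L : fieldExtType K) (E : {subfield L}).
Variables (l : nat) (z : L).
Hypotheses (l_pr : prime l) (z_prim : l.-primitive_root z) (zE : z \in E).

Let l_gt0 := prime_gt0 l_pr.

Lemma polyOver_XnsubC (e : L) : e \in E -> 'X^l - e%:P \is a polyOver E.
Proof. by move=> eE; rewrite rpredB ?rpredX ?polyOverX ?polyOverC. Qed.

(** The Bezout argument of [irreducible_Xn_sub], applied to the minimal polynomial of y over [E]: a
    degree below l yields x in [E] with x^l = y^l, and then y, being x times a power of z, lies in
    [E] too. *)
Lemma kummer_adjoin_degree (y : L) :
  y ^+ l \in E -> y \notin E -> adjoin_degree E y = l.
Proof.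
move=> ylE yE; set g := minPoly E y.
have nz_y : y != 0 by apply: contraNneq yE => ->; rewrite rpred0.
have g_dvd : g %| 'X^l - (y ^+ l)%:P.
  by rewrite minPoly_dvdp ?polyOver_XnsubC // rootE !hornerE subrr.
have def_d : (size g).-1 = adjoin_degree E y by rewrite size_minPoly.
have le_dl : (adjoin_degree E y <= l)%N.
  have := dvdp_leq _ g_dvd; rewrite size_XnsubC // -def_d => /(_ _)/leq_trans.
  rewrite -size_poly_gt0 size_XnsubC // => /(_ _ isT (leqnn _)).
  by rewrite size_minPoly.
apply/eqP; rewrite eqn_leq le_dl leqNgt; apply/negP => lt_dl.
have nE : (-1) ^+ adjoin_degree E y * g`_0 \in E.
  by rewrite rpredM ?rpredX ?rpredN1 //; have /polyOverP := minPolyOver E y.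
have := dvdp_Xn_sub_coef0 (monic_minPoly E y) g_dvd; rewrite def_d.
move: nE; set n := _ * _; set d := adjoin_degree E y => nE.
have d_gt0 : (0 < d)%N.
  by rewrite /d adjoin_degreeE divn_gt0 ?adim_gt0 // dimvS // subv_adjoin.
have co_dl : coprime d l by rewrite coprime_sym prime_coprime // gtnNdvd.
case: (egcdnP l d_gt0) => a b def_g _ nl.
pose x := n ^+ a / y ^+ l ^+ b.
have nz_yl : y ^+ l != 0 by rewrite expf_neq0.
have xl : x ^+ l = y ^+ l.
  rewrite exprMn exprVn -!(exprM _ _ l) mulnC exprM nl -exprM [(d * a)%N]mulnC.
  by rewrite def_g (eqP co_dl) exprD expr1 mulrAC divff ?mul1r ?expf_neq0.
have nz_x : x != 0.
  by apply: contraNneq nz_yl => x0; rewrite -xl x0 expr0n gtn_eqF.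
have yx1 : (y / x) ^+ l = 1 by rewrite exprMn exprVn xl divff.
have [i def_y] := prim_rootP z_prim yx1.
case/negP: yE; rewrite -[y](divfK nz_x) def_y.
apply: rpredM; first exact: rpredX.
by apply: rpredM; [exact: rpredX | rewrite rpredV; exact: rpredX].
Qed.

(* As X^l - y^l is invariant under X -> z X, an l-th power in E[X]/(X^l - y^l)
   lying in E changes by a power of z under this substitution. *)
Lemma kummer_radical (x y : L) : y ^+ l \in E -> y \notin E ->
  x \in <<E; y>>%VS -> x ^+ l \in E -> exists k, exists2 c, c \in E & x = c * y ^+ k.
Proof.
move=> ylE yE x_y xlE; have deg_y := kummer_adjoin_degree ylE yE.
have nz_z : z != 0 by rewrite (prim_root_eq0 z_prim) gtn_eqF.
have [-> |nz_x] := eqVneq x 0; first by exists 0%N, 0; rewrite ?rpred0 ?mul0r.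
set h := Fadjoin_poly E y x.
have hE : h \is a polyOver E by apply: Fadjoin_polyOver.
have hy : h.[y] = x by apply: Fadjoin_poly_eq.
have size_h : (size h <= l)%N by rewrite -deg_y size_Fadjoin_poly.
have zy_root : root ('X^l - (y ^+ l)%:P) (z * y).
  by rewrite rootE !hornerE exprMn (prim_expr_order z_prim) mul1r subrr.
have def_min : minPoly E y = 'X^l - (y ^+ l)%:P.
  apply/eqP; rewrite -eqp_monic ?monic_minPoly ?monicXnsubC //.
  rewrite -dvdp_size_eqp ?size_minPoly ?deg_y ?size_XnsubC //.
  by rewrite minPoly_dvdp ?polyOver_XnsubC // rootE !hornerE subrr.
have hzy : h.[z * y] ^+ l = x ^+ l.
  have : root (h ^+ l - (x ^+ l)%:P) (z * y).
    apply: (@root_dvdp _ ('X^l - (y ^+ l)%:P)) zy_root.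
    rewrite -def_min minPoly_dvdp ?rpredB ?rpredX ?polyOverC //.
    by rewrite rootE !hornerE hy subrr.
  by rewrite rootE !hornerE subr_eq0 => /eqP.
have [k def_hzy] : exists k : 'I_l, h.[z * y] / x = z ^+ k.
  have [|k ->] := @prim_rootP _ _ _ z_prim (h.[z * y] / x); last by exists k.
  by rewrite exprMn exprVn hzy divff ?expf_neq0.
(* This polynomial over [E] has degree below l and vanishes at y, because h(z y) = z^k x. Its
   coefficients are (z^i - z^k) h_i, so h is a monomial of degree k. *)
have : h \Po (z *: 'X) - z ^+ k *: h = 0.
  apply/eqP; rewrite -(@root_small_adjoin_poly _ _ E y).
  - rewrite rootE !hornerE horner_comp !hornerE hy -def_hzy divfK // subrr //.
  - rewrite rpredB ?polyOverZ ?rpredX // polyOver_comp ?polyOverZ ?polyOverX //.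
  - rewrite deg_y (leq_trans (size_polyD _ _)) // geq_max size_polyN.
    rewrite size_comp_poly2; last by rewrite size_scale ?size_polyX.
    by rewrite size_scale ?expf_neq0 // size_h.
move=> /polyP h_eq; exists k, h`_k; first by have /polyOverP := hE.
rewrite -hy (horner_coef_wide _ size_h) (bigD1 k) //= big1 ?addr0 // => i ne_ik.
have := h_eq i; rewrite coefB coef_comp_polyZX coefZ coef0 -mulrBl => /eqP.
rewrite mulf_eq0 subr_eq0 (eq_prim_root_expr z_prim) !modn_small //.
by rewrite val_eqE (negPf ne_ik) => /eqP ->; rewrite mul0r.
Qed.

End Kummer.

(** * The polynomials eps and A *)

Section PrimitiveRoot.
Variables (F : fieldType) (l : nat) (z : F).
Hypothesis z_prim : l.-primitive_root z.

Let l_gt0 := prim_order_gt0 z_prim.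

Lemma Xn_sub_exp (e : F) : e != 0 ->
  'X^l - (e ^+ l)%:P = \prod_(0 <= i < l) ('X - (z ^+ i * e)%:P).
Proof.
move=> nz_e; pose rs := [seq z ^+ i * e | i <- index_iota 0 l].
rewrite [LHS](@all_roots_prod_XsubC _ _ rs).
- by rewrite (monicP (monicXnsubC _ l_gt0)) scale1r /rs big_map.
- by rewrite size_XnsubC // size_map size_iota subn0.
- apply/allP => _ /mapP[i _ ->]; rewrite rootE !hornerE exprMn exprAC.
  by rewrite (prim_expr_order z_prim) expr1n mul1r subrr.
rewrite uniq_rootsE map_inj_in_uniq ?iota_uniq // => i j.
rewrite !mem_index_iota => /andP[_ ltil] /andP[_ ltjl] /(mulIf nz_e)/eqP.
by rewrite (eq_prim_root_expr z_prim) !modn_small // => /eqP.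
Qed.

Lemma subX_prim_root (y : F) : 1 - y ^+ l = \prod_(0 <= i < l) (1 - z ^+ i * y).
Proof.
have [->|nz_y] := eqVneq y 0.
  by rewrite expr0n gtn_eqF // subr0 big1 // => i _; rewrite mulr0 subr0.
have := congr1 (horner^~ 1) (Xn_sub_exp nz_y).
rewrite !hornerE horner_prod expr1n => ->.
by apply: eq_bigr => i _; rewrite !hornerE.
Qed.

(** Passing from y to z y lowers the exponent of 1 - z^i y from i to i - 1 for 0 < i < l and raises
    that of 1 - y from 0 to l - 1. The factor 1 - y^l adds one to every exponent. *)
Lemma eps_ratio (y : F) :
  eps l z 1 y * (1 - y ^+ l) = eps l z 0 y * (1 - y) ^+ l.
Proof.
rewrite subX_prim_root big_ltn // expr0 mul1r.
have -> : eps l z 1 y = \prod_(1 <= i < l.+1) (1 - z ^+ i * y) ^+ i.-1.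
  by rewrite big_ltn // expr0 mul1r big_add1 /=; apply: eq_bigr => i _; rewrite addn1.
rewrite big_nat_recr //= (prim_expr_order z_prim) mul1r.
rewrite [X in _ * X = _]mulrC mulrACA -exprSr prednK //; congr (_ * _).
rewrite -big_split /=; apply: eq_big_nat => i /andP[i_gt0 _].
by rewrite addn0 -exprSr prednK.
Qed.

Lemma mup_subXn (x : F) : x ^+ l = 1 -> mup x (1 - 'X^l) = 1%N.
Proof.
move=> xl1; have -> : 1 - 'X^l = (-1)%:P * ('X^l - 1) :> {poly F}.
  by rewrite polyCN mulN1r opprB.
rewrite mupMr; last by rewrite rootC oppr_eq0 oner_eq0.
rewrite -(factor_Xn_sub_1 z_prim).
have -> : \prod_(0 <= i < l) ('X - (z ^+ i)%:P)
   = \prod_(y <- [seq z ^+ i | i <- index_iota 0 l]) ('X - y%:P).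
  by rewrite big_map.
have [i ->] := prim_rootP z_prim xl1.
rewrite mu_prod_XsubC count_uniq_mem; last first.
  rewrite map_inj_in_uniq ?iota_uniq // => j k.
  rewrite !mem_index_iota => /andP[_ ltjl] /andP[_ ltkl] /eqP.
  by rewrite (eq_prim_root_expr z_prim) !modn_small // => /eqP.
by rewrite map_f // mem_index_iota /=.
Qed.

Definition eps_poly : {poly F} := eps l z%:P 0 'X.

Lemma horner_eps_poly (y : F) : eps_poly.[y] = eps l z 0 y.
Proof.
by rewrite -horner_evalE /eps_poly rmorph_eps /= !horner_evalE hornerX hornerC.
Qed.

Lemma eps_polyE : eps_poly = \prod_(1 <= i < l) (1 - z ^+ i *: 'X) ^+ i.
Proof. by apply: eq_bigr => i _; rewrite addn0 -polyC_exp mul_polyC. Qed.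

Lemma root_sub1Z (i : nat) (x : F) :
  root ((1 - z ^+ i *: 'X) ^+ i) x = (0 < i)%N && (z ^+ i * x == 1).
Proof.
rewrite rootE !hornerE expf_eq0 subr_eq0 [1 == _]eq_sym.
by case: i.
Qed.

Lemma eps_poly_neq0 : eps_poly != 0.
Proof.
rewrite eps_polyE prodf_seq_neq0; apply/allP => i _ /=; rewrite expf_neq0 //.
apply: contraTneq (oner_neq0 F) => /(congr1 (horner^~ 0)).
by rewrite !hornerE ?mulr0 ?subr0 => ->; rewrite eqxx.
Qed.

Lemma eps_neq0 (y : F) : y ^+ l != 1 -> eps l z 0 y != 0.
Proof.
move=> yl; rewrite prodf_seq_neq0; apply/allP => i _ /=; rewrite expf_neq0 //.
apply: contraNneq yl => /subr0_eq zy1; apply/eqP.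
have := congr1 (fun x => x ^+ l) zy1; rewrite addn0 /= => /esym.
by rewrite expr1n exprMn exprAC (prim_expr_order z_prim) expr1n mul1r.
Qed.

Lemma mup_eps_poly_1 : mup 1 eps_poly = 0%N.
Proof.
rewrite mupNroot // rootE horner_eps_poly prodf_seq_neq0; apply/allP => i.
rewrite mem_index_iota => /andP[i_gt0 ltil] /=; rewrite expf_neq0 //.
rewrite addn0 mulr1 subr_eq0 eq_sym -(expr0 z) (eq_prim_root_expr z_prim).
by rewrite mod0n modn_small // -lt0n.
Qed.

(** For 0 < i < l, z^i z^-1 = 1 forces i = 1, and that factor has exponent 1. *)
Lemma mup_eps_poly_V : (1 < l)%N -> mup z^-1 eps_poly = 1%N.
Proof.
move=> l_gt1; rewrite eps_polyE big_ltn // mupMl; last first.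
  rewrite rootE horner_prod prodf_seq_neq0; apply/allP => i.
  rewrite mem_index_iota => /andP[i_gt1 ltil] /=.
  change (~~ root ((1 - z ^+ i *: 'X) ^+ i) z^-1).
  rewrite root_sub1Z; case: i i_gt1 ltil => // i i_gt0 ltil.
  rewrite exprSr mulfK ?(prim_root_eq0 z_prim) ?gtn_eqF //=.
  by rewrite -(expr0 z) (eq_prim_root_expr z_prim) mod0n modn_small ?gtn_eqF // ltnW.
have nz_z : z != 0 by rewrite (prim_root_eq0 z_prim) gtn_eqF.
rewrite !expr1; have -> : 1 - z *: 'X = (- z)%:P * ('X - (z^-1)%:P).
  by rewrite mulrBr -polyCM mulNr divff // !polyCN opprK mulNr addrC mul_polyC.
rewrite mupMr ?rootC ?oppr_eq0 //.
by rewrite -[_ - _]expr1 mup_XsubCX eqxx.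
Qed.

Lemma mupX (x : F) (q : {poly F}) n : q != 0 -> mup x (q ^+ n) = (n * mup x q)%N.
Proof.
move=> nz_q; elim: n => [|n IHn]; last by rewrite exprS mupM ?expf_neq0 // IHn mulSn.
by rewrite expr0 mupNroot // root1.
Qed.

Lemma subXn_neq0 : 1 - 'X^l != 0 :> {poly F}.
Proof. by rewrite -oppr_eq0 opprB -size_poly_gt0 size_XnsubC. Qed.

(** The multiplicities at 1 of the two sides are 1 and 0 modulo l. The factor D clears the
    denominator of a would-be l-th root in F(X). *)
Lemma subXn_nradical (D q : {poly F}) :
  (1 < l)%N -> D != 0 -> D ^+ l * (1 - 'X^l) != q ^+ l.
Proof.
move=> l_gt1 nz_D; apply/eqP => eqDq.
have nz_q : q != 0.
  apply: contraTneq (mulf_neq0 (expf_neq0 l nz_D) subXn_neq0) => q0.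
  by rewrite eqDq q0 expr0n gtn_eqF ?eqxx.
have := congr1 (mup 1) eqDq; rewrite mupM ?expf_neq0 ?subXn_neq0 //.
rewrite !mupX // mup_subXn ?expr1n // => /(congr1 (modn^~ l)).
by rewrite mulnC modnMDl modnMr modn_small.
Qed.

(** Multiplicities modulo l: at 1 an equality would give 0 = k, at z^-1 it would give 1 = k. *)
Lemma eps_poly_nradical (D q : {poly F}) k :
  (1 < l)%N -> D != 0 -> D ^+ l * eps_poly != q ^+ l * (1 - 'X^l) ^+ k.
Proof.
move=> l_gt1 nz_D; apply/eqP => eqDq.
have nz_q : q != 0.
  apply: contraTneq (mulf_neq0 (expf_neq0 l nz_D) eps_poly_neq0) => q0.
  by rewrite eqDq q0 expr0n gtn_eqF // mul0r eqxx.
have mupE x : (l * mup x D + mup x eps_poly = l * mup x q + k * mup x (1 - 'X^l))%N.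
  have := congr1 (mup x) eqDq.
  by rewrite !mupM ?expf_neq0 ?subXn_neq0 ?eps_poly_neq0 // !mupX ?subXn_neq0.
have zV : z^-1 ^+ l = 1 by rewrite exprVn (prim_expr_order z_prim) invr1.
have := congr1 (modn^~ l) (mupE z^-1); have := congr1 (modn^~ l) (mupE 1).
rewrite !mup_subXn ?expr1n // mup_eps_poly_1 mup_eps_poly_V // !muln1.
by rewrite addn0 modnMr ![(l * _)%N]mulnC !modnMDl => <-; rewrite modn_small.
Qed.

End PrimitiveRoot.

(** * Power residues in ['F_p] and the value of A at an l-th power *)

Section PrimeField.
Variables (p l : nat) (z : 'F_p).
Hypotheses (p_pr : prime p) (l_pr : prime l) (l_dvd : (l %| p.-1)%N).
Hypothesis z_prim : l.-primitive_root z.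

Lemma Fp_expf_pred (x : 'F_p) : x != 0 -> x ^+ p.-1 = 1.
Proof.
move=> nz_x; apply: (mulfI nz_x); rewrite mulr1 -exprS prednK ?prime_gt0 //.
by have := expf_card x; rewrite /= card_Fp.
Qed.

(** Euler's criterion for l-th powers. If x = g^i for a generator g of the cyclic unit group, the
    left side says that p - 1 divides i (p - 1) / l, that is, that l divides i. *)
Lemma Fp_exp_root (x : 'F_p) : x != 0 ->
  (x ^+ (p.-1 %/ l) == 1) = [exists y : 'F_p, y ^+ l == x].
Proof.
move=> nz_x; apply/eqP/existsP => [x1|[y /eqP yl]]; last first.
  rewrite -yl -exprM mulnC divnK // Fp_expf_pred //.
  by apply: contraNneq nz_x => y0; rewrite -yl y0 expr0n gtn_eqF ?prime_gt0.
have p1_gt0 : (0 < p.-1)%N by rewrite -subn1 subn_gt0 prime_gt1.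
have [g g_prim] : exists g : 'F_p, p.-1.-primitive_root g.
  have : has p.-1.-primitive_root [seq y <- enum 'F_p | y != 0].
    apply: cyclic.has_prim_root => //.
    - apply/allP => y; rewrite mem_filter => /andP[nz_y _].
      by rewrite unity_rootE Fp_expf_pred.
    - by rewrite filter_uniq ?enum_uniq.
    rewrite enumT -[X in (_ <= size X)%N]/(enum (predC1 (0 : 'F_p))) -cardE.
    by rewrite cardC1 card_Fp.
  by case/hasP => g _ ?; exists g.
have [i def_x] := prim_rootP g_prim (Fp_expf_pred nz_x).
have : (l %| i)%N.
  move/eqP: x1; rewrite def_x -exprM -(prim_order_dvd g_prim).
  rewrite -{1}(divnK l_dvd) mulnC dvdn_pmul2r // divn_gt0 ?prime_gt0 //.
  exact: dvdn_leq.
by case/dvdnP => k def_i; exists (g ^+ k); rewrite -exprM -def_i def_x.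
Qed.

(** Raise [eps_ratio] to the power (p - 1) / l: the factor (1 - y)^l becomes (1 - y)^(p - 1) = 1,
    and 1 - y^l = 1 - b^l contributes 1 by hypothesis. *)
Lemma eps_exp_shift (b : 'F_p) j : b ^+ l != 1 -> (1 - b ^+ l) ^+ (p.-1 %/ l) = 1 ->
  eps l z 0 (z ^+ j * b) ^+ (p.-1 %/ l) = eps l z 0 b ^+ (p.-1 %/ l).
Proof.
move=> bl1 b1; elim: j => [|j IHj]; first by rewrite mul1r.
rewrite -{}IHj exprS -mulrA; set y := z ^+ j * b.
have yl : y ^+ l = b ^+ l.
  by rewrite exprMn exprAC (prim_expr_order z_prim) expr1n mul1r.
move: y yl => y yl; rewrite -[z in z * y]expr1 -eps_shift.
have y1 : 1 - y != 0.
  by rewrite subr_eq0 eq_sym; apply: contraNneq bl1 => y1; rewrite -yl y1 expr1n.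
have := congr1 (fun x => x ^+ (p.-1 %/ l)) (eps_ratio z_prim y).
rewrite /= !exprMn yl b1 mulr1 => ->.
by rewrite -exprM mulnC divnK // Fp_expf_pred ?mulr1.
Qed.

(** By [eps_exp_shift] the l terms of the mean defining A coincide; l is invertible because a
    primitive l-th root of unity exists. *)
Lemma A_poly_exp (b : 'F_p) : b ^+ l != 1 -> (1 - b ^+ l) ^+ (p.-1 %/ l) = 1 ->
  (A_poly l p z).[b ^+ l] = eps l z 0 b ^+ (p.-1 %/ l).
Proof.
move=> bl1 b1; have := congr1 (horner^~ b) (A_polyE p z_prim).
rewrite /= horner_comp hornerXn => ->; rewrite /A_root hornerZ horner_sum.
rewrite (eq_bigr (fun=> eps l z 0 b ^+ (p.-1 %/ l))) => [|j _].
  rewrite sumr_const_nat subn0 -[X in _ * X]mulr_natl mulKf //.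
  exact: prim_root_natf_neq0 z_prim.
rewrite -(eps_exp_shift j bl1 b1) horner_exp -eps_shift -horner_evalE rmorph_eps /=.
by rewrite !horner_evalE hornerX hornerC.
Qed.

End PrimeField.

(** * Prime ideals and localisation *)

Section Evp.
Variables (B S : comNzRingType) (f : {rmorphism B -> S}) (y : S).

(** Iterated, this presents F[u, v, w] as the image of a polynomial ring in three variables, so that
    the maps to the field, to its integral closure and to F have one common source. *)
Definition evp : {poly B} -> S := horner_eval y \o map_poly f.
HB.instance Definition _ := GRing.RMorphism.on evp.

Lemma evpE h : evp h = (map_poly f h).[y]. Proof. by []. Qed.
Lemma evpC b : evp b%:P = f b. Proof. by rewrite evpE map_polyC hornerC. Qed.
Lemma evpX : evp 'X = y. Proof. by rewrite evpE map_polyX hornerX. Qed.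
Lemma evp_XnsubC n b : evp ('X^n - b%:P) = y ^+ n - f b.
Proof. by rewrite rmorphB rmorphXn /= evpX evpC. Qed.
Lemma evpMXaddC h b : evp (h * 'X + b%:P) = evp h * y + f b.
Proof. by rewrite rmorphD rmorphM /= evpX evpC. Qed.

End Evp.

Lemma rmorph_evp (B S T : comNzRingType) (f : {rmorphism B -> S})
    (g : {rmorphism S -> T}) (fg : {rmorphism B -> T}) y h :
  (forall b, g (f b) = fg b) -> g (evp f y h) = evp fg (g y) h.
Proof.
move=> gf; rewrite !evpE -horner_map -map_poly_comp; congr _.[_].
exact: eq_map_poly.
Qed.

Section AdjoinLayer.
Variables (K : fieldType) (L : fieldExtType K) (E : {subfield L}) (y : L).

Lemma adjoin_closed (T : L -> Prop) : (forall x, x \in E -> T x) -> T y ->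
  (forall x x', T x -> T x' -> T (x + x')) ->
  (forall x x', T x -> T x' -> T (x * x')) -> forall x, x \in <<E; y>>%VS -> T x.
Proof.
move=> TE Ty TD TM _ /Fadjoin_polyP[h /polyOverP hE ->].
rewrite horner_coef; apply: big_ind => // [|i _]; first by apply: (TE); rewrite rpred0.
apply: (TM); first exact: (TE).
by elim: (i : nat) => [|n IHn]; [apply: (TE); rewrite rpred1|rewrite exprS; apply: (TM)].
Qed.

Variables (B : comNzRingType) (f : {rmorphism B -> L}).
Hypothesis fE : forall b, f b \in E.

Lemma map_polyOver_layer h : map_poly f h \is a polyOver E.
Proof. by apply/polyOverP => i; rewrite coef_map /= fE. Qed.

Lemma evp_adjoin h : evp f y h \in <<E; y>>%VS.
Proof. by rewrite evpE mempx_Fadjoin ?map_polyOver_layer. Qed.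

(** Division by the monic X^l - c replaces h by a remainder of degree below l. As y has degree l
    over [E], the coefficients of the remainder lie in the kernel of f, hence in that of g. In this
    way evaluation at a point descends to F[u, v, w] one variable at a time. *)
Lemma evp_ker (S : comNzRingType) (g : {rmorphism B -> S}) (l : nat) (c : B) (d : S) :
  (0 < l)%N -> adjoin_degree E y = l -> y ^+ l = f c -> d ^+ l = g c ->
  (forall b, f b = 0 -> g b = 0) -> forall h, evp f y h = 0 -> evp g d h = 0.
Proof.
move=> l_gt0 deg_y yl dl ker_fg h; set q := 'X^l - c%:P.
have q_monic : q \is monic by rewrite monicXnsubC.
have eval_q (T : comNzRingType) (k : {rmorphism B -> T}) e :
    e ^+ l = k c -> evp k e q = 0.
  by move=> el; rewrite evp_XnsubC el subrr.
rewrite (Pdiv.RingMonic.rdivp_eq q_monic h) !rmorphD !rmorphM /= !eval_q //.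
rewrite !mulr0 !add0r; set r := Pdiv.Ring.rmodp _ _ => fr0.
have size_r : (size r <= l)%N.
  by have := Pdiv.Ring.ltn_rmodpN0 h (monic_neq0 q_monic); rewrite size_XnsubC.
have /eqP/polyP fr : map_poly f r == 0.
  rewrite -(root_small_adjoin_poly (x := y) (map_polyOver_layer r)); first exact/eqP.
  by rewrite deg_y (leq_trans (size_poly _ _)).
rewrite evpE (_ : map_poly g r = 0) ?horner0 //; apply/polyP => i.
by rewrite coef_map coef0; apply: ker_fg; rewrite -coef_map fr coef0.
Qed.

End AdjoinLayer.

(** [Prop]-valued and without properness, so that it covers both the traces of primes and
    [princ]. *)
Definition ideal_pred (A : comNzRingType) (N : A -> Prop) : Prop :=
  [/\ N 0, forall x y, N x -> N y -> N (x + y) & forall c x, N x -> N (c * x)].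

Lemma ideal_predC (B : comNzRingType) (N : {poly B} -> Prop) :
  ideal_pred N -> ideal_pred (fun b => N b%:P).
Proof.
by case=> N0 ND NM; split=> // [x y|c x];
  rewrite ?polyCD ?polyCM; [apply: (ND)|apply: (NM)].
Qed.

Lemma ideal_pred_sub (A : comNzRingType) (N : A -> Prop) x y :
  ideal_pred N -> N (x - y) -> (N x <-> N y).
Proof.
case=> N0 ND NM Nxy; split=> [Nx|Ny]; last by rewrite -[x](subrK y); apply: (ND).
by rewrite -[y](subKr x); apply: (ND) => //; rewrite -mulN1r; apply: (NM).
Qed.

Section Congruence.
Variables (F B : comNzRingType) (g : {rmorphism B -> F}) (iota : {rmorphism F -> B}).
Variable N : {poly B} -> Prop.
Hypotheses (idN : ideal_pred N) (NB : forall b, N (b - iota (g b))%:P).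

Lemma map_congr h : N (h - map_poly iota (map_poly g h)).
Proof.
have [N0 ND NM] := idN; elim/poly_ind: h => [|h b IHh]; first by rewrite !rmorph0 subr0.
rewrite !rmorphD !rmorphM /= !map_polyX !map_polyC /= opprD addrACA -mulrBl.
by apply: (ND); [rewrite mulrC; apply: (NM) | rewrite -polyCB].
Qed.

Lemma evp_congr d : N ('X - (iota d)%:P) -> forall h, N (h - (iota (evp g d h))%:P).
Proof.
have [N0 ND NM] := idN; move=> Nd.
elim/poly_ind=> [|h b IHh]; first by rewrite !rmorph0 subr0.
rewrite !rmorphD !rmorphM /= evpX evpC opprD addrACA -polyCB.
apply: (ND) => //; set e := (iota _)%:P in IHh *.
have -> : h * 'X - e * (iota d)%:P = 'X * (h - e) + e * ('X - (iota d)%:P).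
  by rewrite mulrBr mulrBr addrA mulrC ['X * e]mulrC subrK.
by apply: (ND); apply: (NM).
Qed.

End Congruence.

Definition prime_pred (A : comNzRingType) (m : A -> Prop) : Prop :=
  [/\ ideal_pred m, ~ m 1 & forall x y, m (x * y) -> m x \/ m y].

Lemma idealr_pred (O : comNzRingType) (P : {pred O}) :
  idealr_closed P -> ideal_pred (fun x => x \in P).
Proof.
case=> P0 _ PM; split=> // [x y Px Py|c x Px]; first by rewrite -[x]mul1r PM.
by rewrite -[_ * _]addr0 PM.
Qed.

Lemma prime_pred_preim (A O : comNzRingType) (psi : {rmorphism A -> O}) (P : {pred O}) :
  idealr_closed P -> prime_idealr_closed P -> prime_pred (fun y => psi y \in P).
Proof.
move=> idP primeP; have [P0 PD PM] := idealr_pred idP; split.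
- split=> [|x y|c x]; rewrite ?(rmorph0 psi) ?(rmorphD psi) ?(rmorphM psi) //.
    exact: PD.
  exact: PM.
- by rewrite rmorph1; case: idP => _ /negP.
by move=> x y; rewrite rmorphM => /primeP/orP.
Qed.

Lemma prime_pred_ker (A : comNzRingType) (F : idomainType) (ev : {rmorphism A -> F}) :
  prime_pred (fun y => ev y = 0).
Proof.
split=> [|/eqP|x y /eqP]; last first.
- by rewrite rmorphM mulf_eq0 => /orP[]/eqP; [left | right].
- by rewrite rmorph1 oner_eq0.
split=> [|x y ex ey|c x ex]; first exact: rmorph0.
  by rewrite rmorphD ex ey addr0.
by rewrite rmorphM ex mulr0.
Qed.

Section Principal.
Variables (A O : comNzRingType) (psi : {rmorphism A -> O}) (pi : A).
Variable m : A -> Prop.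
Hypotheses (m_prime : prime_pred m).

(* y lies in the ideal generated by pi in the localisation of psi(A) at m. *)
Definition princ (y : A) : Prop := exists s y', ~ m s /\ psi (s * y) = psi (pi * y').

Lemma princ_ideal : ideal_pred princ.
Proof.
have [_ m1 mP] := m_prime.
split=> [|x y [s [x' [ms ex]]] [t [y' [mt ey]]]|c x [s [x' [ms ex]]]].
- by exists 1, 0; rewrite !mulr0.
- exists (s * t), (t * x' + s * y'); split; first by move=> /mP[].
  rewrite !rmorphM /= in ex ey; rewrite !(rmorphD, rmorphM) /= !mulrDr.
  by rewrite ![psi pi * _]mulrCA -ex -ey; ring.
exists s, (c * x'); split=> //; rewrite !rmorphM /= in ex *.
by rewrite [psi pi * _]mulrCA -ex; ring.
Qed.

Lemma princ_pi : princ pi.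
Proof. by have [_ m1 _] := m_prime; exists 1, 1; rewrite mul1r mulr1. Qed.

Lemma princ_psi y y' : psi y = psi y' -> princ y -> princ y'.
Proof. by move=> eqy [s [x [ms ex]]]; exists s, x; rewrite rmorphM -eqy -rmorphM. Qed.

Variables (F : fieldType) (iota : {rmorphism F -> A}).

(** A nonzero constant is a unit, and m is proper. *)
Lemma prime_pred_const c : m (iota c) <-> c = 0.
Proof.
have [[m0 _ mM] m1 _] := m_prime; split=> [mc|->]; last by rewrite rmorph0.
apply: contrapT => /eqP nz_c; apply: m1.
by rewrite -(rmorph1 iota) -(mulVf nz_c) rmorphM; apply: mM.
Qed.

Lemma prime_root (l : nat) (z : F) x c : l.-primitive_root z -> c != 0 ->
  m (x ^+ l - iota (c ^+ l)) -> exists i : 'I_l, m (x - iota (z ^+ i * c)).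
Proof.
have [_ m1 mP] := m_prime; move=> z_prim nz_c.
have -> : x ^+ l - iota (c ^+ l) = \prod_(i < l) (x - iota (z ^+ i * c)).
  have := congr1 (evp iota x) (Xn_sub_exp z_prim nz_c).
  rewrite evp_XnsubC => ->; rewrite rmorph_prod big_mkord.
  by apply: eq_bigr => i _; apply: (evp_XnsubC _ _ 1).
move=> m_prod; apply: contrapT => no_root; move: m_prod.
apply: (big_ind (fun y => ~ m y)) => // [y y' my my'|i _ mi]; first by move=> /mP[].
by apply: no_root; exists i.
Qed.

(* The cofactor of x - e in x^l - e^l is congruent to l e^(l-1). *)
Lemma princ_root (l : nat) x e y : l%:R != 0 :> F -> e != 0 ->
  m (x - iota e) -> princ y -> psi (x ^+ l - iota (e ^+ l)) = psi y ->
  princ (x - iota e).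
Proof.
have [[m0 mD mM] m1 mP] := m_prime; move=> nz_l nz_e mx py eqy.
have [s [y' [ms es]]] := py.
have mX k : m (x ^+ k - iota e ^+ k) by rewrite subrXX mulrC; apply: mM.
pose Q := \sum_(i < l) x ^+ (l.-1 - i) * iota e ^+ i.
exists (s * Q), y'; split.
  move=> /mP[//|mQ]; have : m (iota (l%:R * e ^+ l.-1)).
    have -> : iota (l%:R * e ^+ l.-1)
        = Q + - 1 * \sum_(i < l) iota e ^+ i * (x ^+ (l.-1 - i) - iota e ^+ (l.-1 - i)).
      rewrite mulN1r -sumrB (eq_bigr (fun=> iota e ^+ l.-1)) => [|i _].
        by rewrite sumr_const card_ord rmorphM rmorph_nat rmorphXn mulr_natl.
      rewrite mulrBr opprB addrCA [iota e ^+ i * x ^+ _]mulrC subrr addr0.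
      by rewrite -exprD subnKC // -ltnS prednK ?(leq_ltn_trans _ (ltn_ord i)).
    apply: (mD) => //; apply: (mM); apply: big_ind => // i _; exact: (mM).
  move=> /prime_pred_const/eqP.
  by rewrite mulf_eq0 (negPf nz_l) expf_eq0 (negPf nz_e) andbF.
rewrite -es !(rmorphM psi s) /= -eqy rmorphXn subrXX /= !rmorphM /=.
by rewrite -/Q; ring.
Qed.

End Principal.

Section Localisation.
Variables (F : fieldType) (A O : comNzRingType) (psi : {rmorphism A -> O}).
Variables (tau : {rmorphism {poly F} -> A}) (a : F) (m : A -> Prop).
Hypothesis m_prime : prime_pred m.
Hypothesis m_ker : forall y, psi y = 0 -> m y.
Hypothesis m_tau : forall D, m (tau D) <-> D.[a] = 0.
Local Notation pi := (tau ('X - a%:P)).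
Hypothesis m_princ : forall y, m y -> princ psi pi m y.
Hypothesis pi_reg : forall x, psi pi * x = 0 -> x = 0.
Hypothesis O_frac : forall x, exists D y, D != 0 /\ psi (tau D) * x = psi y.
Hypothesis O_int : forall x, exists n (c : nat -> A),
  x ^+ n = \sum_(i < n) psi (c i) * x ^+ i.

Let m_exp x n : m (x ^+ n) -> m x.
Proof.
have [_ m1 mP] := m_prime.
by elim: n => [/m1//|n IHn]; rewrite exprS => /mP[].
Qed.

(* An element of O of the shape y / (s pi^n) is reduced to n = 0: if y lies in m
   then a factor pi cancels, and otherwise the inverse of the element would lie
   in the maximal ideal of the local ring, against integrality. *)
Lemma integral_localised x : exists s y, ~ m s /\ psi s * x = psi y.
Proof.
have [[m0 mD mM] _ mP] := m_prime.
have m_pi : m pi by apply/m_tau; rewrite !hornerE subrr.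
have reduce n s y : ~ m s -> psi (s * pi ^+ n) * x = psi y ->
    exists s y, ~ m s /\ psi s * x = psi y.
  elim: n s y => [|n IHn] s y Ns def_y; first by exists s, y; rewrite -def_y mulr1.
  have [my|Nmy] := pselect (m y).
    have [s' [y' [Ns' sy]]] := m_princ my.
    apply: (IHn (s' * s) y'); first by move=> /mP[].
    apply/eqP; rewrite -subr_eq0; apply/eqP/pi_reg.
    rewrite !rmorphM /= in sy; rewrite mulrBr -sy -def_y !rmorphM /= exprS !rmorphM.
    by rewrite !rmorphXn /=; ring.
  have mz : m (s * pi ^+ n.+1) by rewrite exprSr mulrA; apply: (mM).
  case: Nmy; move: (s * _) mz def_y => z mz def_y.
  have [N [c xN]] := O_int x; apply: (m_exp (n := N)).
  (* Since [psi z * x = psi y], multiplying the integral equation of x by the N-th power of [psi z]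
     gives y^N = e modulo the kernel of [psi]. Every term of e contains a positive power of z, so e
     lies in m. *)
  pose e := \sum_(i < N) c i * y ^+ i * z ^+ (N - i).
  have -> : y ^+ N = (y ^+ N - e) + e by rewrite subrK.
  apply: (mD); last first.
    rewrite /e; apply: big_ind => // i _; apply: (mM).
    by rewrite -(prednK (_ : 0 < N - i)%N) ?subn_gt0 // exprSr; apply: (mM).
  apply: m_ker; rewrite rmorphB rmorphXn /= -def_y exprMn xN mulr_sumr rmorph_sum /=.
  rewrite -sumrB big1 // => i _; rewrite !rmorphM !rmorphXn /= -def_y.
  have -> : psi z ^+ N = psi z ^+ (N - i) * psi z ^+ i.
    by rewrite -exprD subnK // ltnW.
  rewrite exprMn; move: (psi z ^+ (N - i)) (psi z ^+ i) (x ^+ i) => *; ring.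
have [D [y [nzD def_y]]] := O_frac x.
(* D = q (X - a)^n with q(a) nonzero, so [tau q] is outside m and only the power of pi has to be
   removed. *)
have [n [q]] := multiplicity_XsubC D a; rewrite nzD /= => q_a defD.
apply: (reduce n (tau q) y); first by move/m_tau/eqP; rewrite -rootE (negPf q_a).
by rewrite -rmorphXn -rmorphM -defD.
Qed.

End Localisation.

(** * The prime ideal attached to a point *)

Section PointIdeal.
Variables (F : fieldType) (A O : comNzRingType) (psi : {rmorphism A -> O}).
Variable ev : {rmorphism A -> F}.
Hypothesis ker_psi : forall y, psi y = 0 -> ev y = 0.
Hypothesis loc : forall x, exists s y, ev s != 0 /\ psi s * x = psi y.

(** The maximal ideal of the localisation of psi(A) at the kernel of [ev], contracted to [O]. *)
Definition point_ideal (x : O) : bool :=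
  `[< exists s y, [/\ ev s != 0, ev y = 0 & psi s * x = psi y] >].

(** Two fractions y / s and y' / s' for x satisfy psi(s' y) = psi(s y'), so by [ker_psi] membership
    does not depend on the fraction. *)
Lemma point_idealP s y x : ev s != 0 -> psi s * x = psi y ->
  (x \in point_ideal) = (ev y == 0).
Proof.
move=> nz_s def_y; apply/asboolP/eqP => [|y0]; last by exists s, y.
move=> [s' [y' [nz_s' y'0 def_y']]].
have : ev (s' * y - s * y') = 0.
  by apply: ker_psi; rewrite rmorphB !rmorphM /= -def_y -def_y' mulrCA subrr.
rewrite rmorphB !rmorphM /= y'0 mulr0 subr0 => /eqP.
by rewrite mulf_eq0 (negPf nz_s') => /eqP.
Qed.

Lemma psi_point_ideal y : (psi y \in point_ideal) = (ev y == 0).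
Proof. by apply: (@point_idealP 1); rewrite rmorph1 ?oner_neq0 ?mul1r. Qed.

Lemma point_ideal_closed : idealr_closed point_ideal.
Proof.
split=> [||c u v Pu Pv].
- by rewrite -(rmorph0 psi) psi_point_ideal rmorph0.
- by rewrite -(rmorph1 psi) psi_point_ideal rmorph1 oner_eq0.
have [s1 [y1 [n1 e1]]] := loc c.
have [s2 [y2 [n2 e2]]] := loc u; have [s3 [y3 [n3 e3]]] := loc v.
move: Pu Pv; rewrite (point_idealP n2 e2) (point_idealP n3 e3) => /eqP y2_0 /eqP y3_0.
rewrite (@point_idealP (s1 * s2 * s3) (y1 * y2 * s3 + y3 * (s1 * s2))).
- by rewrite rmorphD !rmorphM /= y2_0 y3_0 mulr0 !mul0r addr0.
- by rewrite !rmorphM /= !mulf_neq0.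
rewrite rmorphD !rmorphM /= -e1 -e2 -e3.
ring.
Qed.

Lemma point_ideal_prime : prime_idealr_closed point_ideal.
Proof.
move=> u v; have [s1 [y1 [n1 e1]]] := loc u; have [s2 [y2 [n2 e2]]] := loc v.
rewrite (point_idealP n1 e1) (point_idealP n2 e2).
rewrite (@point_idealP (s1 * s2) (y1 * y2)).
- by rewrite rmorphM mulf_eq0.
- by rewrite rmorphM mulf_neq0.
by rewrite !rmorphM /= mulrACA e1 e2.
Qed.

End PointIdeal.

(** * The Heisenberg extension and its primes above X - a *)

Lemma fraction_repr (D : idomainType) (x : {fraction D}) :
  exists n d : D, d != 0 /\ tofrac d * x = tofrac n.
Proof.
elim/quotW: x => x; exists \n_x, \d_x; split; first exact: denom_ratioP.
rewrite -[_ * _]/(FracField.mul _ _); apply/eqP.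
rewrite !piE FracField.equivfE /FracField.mulf.
by rewrite !numden_Ratio ?mulf_neq0 ?denom_ratioP ?oner_eq0 // mul1r mulr1.
Qed.

Section IntclMorphism.
Variables (B : comNzRingType) (K : fieldType) (f : {rmorphism B -> K}).

Fact intcl_of_zmod_morphism : zmod_morphism (intcl_of f).
Proof. by move=> x y; apply: val_inj; rewrite /= rmorphB. Qed.
Fact intcl_of_monoid_morphism : monoid_morphism (intcl_of f).
Proof. by split=> [|x y]; apply: val_inj; rewrite /= (rmorph1, rmorphM). Qed.
HB.instance Definition _ := GRing.isZmodMorphism.Build _ _ _ intcl_of_zmod_morphism.
HB.instance Definition _ := GRing.isMonoidMorphism.Build _ _ _ intcl_of_monoid_morphism.

Lemma integral_exp (x : K) n : (0 < n)%N -> integralOver f (x ^+ n) -> integralOver f x.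
Proof.
move=> n_gt0 int_xn; apply: (@integral_root_monic _ _ _ _ ('X^n - (x ^+ n)%:P)).
- exact: monicXnsubC.
- by rewrite rootE !hornerE subrr.
apply/integral_poly => i; rewrite coefB coefXn coefC.
by apply: integral_sub; [exact: integral_nat | case: eqP => _ //; exact: integral0].
Qed.

End IntclMorphism.

Lemma card_setT_fin (T : finType) : ([set: T] #= `I_#|T|)%card.
Proof.
apply/card_set_bijP; exists (fun t => enum_rank t : nat); split=> [t _||n /= n_lt] /=.
- exact: ltn_ord.
- by move=> t t' _ _ /val_inj/enum_rank_inj.
by exists (enum_val (Ordinal n_lt)) => //; rewrite enum_valK.
Qed.

Section Tower.
Variables (F : fieldType) (l : nat) (z : F).
Hypotheses (l_pr : prime l) (z_prim : l.-primitive_root z).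
(* The conditions on e say that K is the fraction field of F[X]. *)
Variables (K : fieldType) (R : fieldExtType K) (e : {rmorphism {poly F} -> R}).
Hypothesis e_eq0 : forall D, (e D == 0) = (D == 0).
Hypothesis e_base : forall D, e D \in 1%VS.
Hypothesis e_frac : forall x, x \in 1%VS -> exists D n, D != 0 /\ e D * x = e n.
Variables u v w : R.
Hypotheses (hu : u ^+ l = e 'X) (hv : v ^+ l = e (1 - 'X)).
Hypothesis hw : w ^+ l = eps l (e z%:P) 0 u.
Hypothesis hR : <<1 & [:: u; v; w]>>%VS = fullv.

Let l_gt0 := prime_gt0 l_pr.
Let l_gt1 := prime_gt1 l_pr.

Definition kappa : F -> R := e \o polyC.
HB.instance Definition _ := GRing.RMorphism.on kappa.

Lemma kappaE c : kappa c = e c%:P. Proof. by []. Qed.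

Lemma e_evp D : e D = evp kappa (u ^+ l) D.
Proof.
rewrite hu; elim/poly_ind: D => [|D c IHD]; first by rewrite !rmorph0.
by rewrite evpMXaddC -IHD rmorphD rmorphM.
Qed.

Lemma evp_comp D : evp kappa u (D \Po 'X^l) = e D.
Proof.
rewrite e_evp; elim/poly_ind: D => [|D c IHD]; first by rewrite !rmorph0.
rewrite comp_polyD comp_polyM comp_polyX comp_polyC evpMXaddC -IHD.
by rewrite rmorphD rmorphM rmorphXn /= evpX evpC.
Qed.

(** If u were algebraic over F, so would be u^l, the image of the variable under the injective
    [e]. *)
Lemma evp_u_eq0 q : evp kappa u q = 0 -> q = 0.
Proof.
move=> uq; apply: contrapT => /eqP nz_q.
have alg_u : algebraicOver kappa u by exists q => //; apply/eqP.
have [D nzD /eqP] : algebraicOver kappa (u ^+ l).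
  elim: l => [|n IHn]; first exact: algebraic1.
  by rewrite exprS; apply: algebraic_mul.
by rewrite -[_.[_]]/(evp kappa (u ^+ l) D) -e_evp => /eqP; rewrite e_eq0 (negPf nzD).
Qed.

Definition E0 : {subfield R} := <<1; u>>%AS.
Definition E1 : {subfield R} := <<E0; v>>%AS.

Lemma kappa_base c (E : {subfield R}) : kappa c \in E.
Proof. by rewrite (subvP (sub1v E)) // e_base. Qed.

Section FracLayer.
Variables (B : comNzRingType) (f : {rmorphism B -> R}) (t : {poly F} -> B).
Hypothesis ft : forall D, f (t D) = e D.

(** Denominators come from F[X] alone, the form in which [integral_localised] takes its
    fractions. *)
Definition is_frac x := exists D b, D != 0 /\ e D * x = f b.

Lemma is_frac_image b : is_frac (f b).
Proof. by exists 1, b; rewrite oner_neq0 rmorph1 mul1r. Qed.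

Lemma is_fracD x y : is_frac x -> is_frac y -> is_frac (x + y).
Proof.
move=> [D [b [nzD Db]]] [D' [b' [nzD' Db']]].
exists (D * D'), (t D' * b + t D * b'); rewrite mulf_neq0 //; split=> //.
by rewrite rmorphD !rmorphM !ft -Db -Db'; ring.
Qed.

Lemma is_fracM x y : is_frac x -> is_frac y -> is_frac (x * y).
Proof.
move=> [D [b [nzD Db]]] [D' [b' [nzD' Db']]].
exists (D * D'), (b * b'); rewrite mulf_neq0 //; split=> //.
by rewrite !rmorphM /= -Db -Db' mulrACA.
Qed.

Lemma is_frac1 x : x \in 1%VS -> is_frac x.
Proof.
by move/e_frac=> [D [n [nzD Dx]]]; exists D, (t n); rewrite ft.
Qed.

End FracLayer.

Lemma is_frac_layer (B : comNzRingType) (f : {rmorphism B -> R}) t (E : {subfield R}) y :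
  (forall D, f (t D) = e D) -> (forall x, x \in E -> is_frac f x) ->
  forall x, x \in <<E; y>>%VS -> is_frac (evp f y) x.
Proof.
move=> ft fE; have ft' D : evp f y (t D)%:P = e D by rewrite evpC ft.
apply: adjoin_closed => [x /fE[D [b [nzD Db]]]|||].
- by exists D, b%:P; split=> //; rewrite Db; apply/esym/evpC.
- by rewrite -[X in is_frac _ X](evpX f y); apply: is_frac_image.
- exact: (is_fracD ft').
- exact: is_fracM.
Qed.

Lemma is_frac_E0 x : x \in E0 -> is_frac (evp kappa u) x.
Proof.
apply: adjoin_closed.
- exact: is_frac1 evp_comp.
- by rewrite -[X in is_frac _ X](evpX kappa u); apply: is_frac_image.
- exact: is_fracD evp_comp.
- exact: is_fracM.
Qed.

Local Notation psi0 := (evp kappa u).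
Local Notation psi1 := (evp psi0 v).
Local Notation psi2 := (evp psi1 w).
Local Notation g := (eps_poly l z).

Lemma psi0_E0 q : psi0 q \in E0.
Proof. by apply: evp_adjoin => c; apply: kappa_base. Qed.

Lemma kappa_prim : l.-primitive_root (kappa z).
Proof. by rewrite fmorph_primitive_root. Qed.

Lemma psi0_subXn : psi0 (1 - 'X^l) = v ^+ l.
Proof. by rewrite hv !rmorphB !rmorph1 rmorphXn /= evpX hu. Qed.

Lemma psi0_eps : psi0 g = w ^+ l.
Proof. by rewrite hw rmorph_eps /= evpX evpC. Qed.

(** If v = q(u) / D(u^l), the l-th power of this identity holds between polynomials, u being
    transcendental, and is excluded by [subXn_nradical]. *)
Lemma v_notin : v \notin E0.
Proof.
apply/negP => /is_frac_E0[D [q [nzD Dq]]].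
have nzDX : D \Po 'X^l != 0.
  by apply: contraNneq nzD => D0; rewrite -e_eq0 -evp_comp D0 rmorph0.
case/negP: (subXn_nradical z_prim q l_gt1 nzDX).
rewrite -subr_eq0; apply/eqP/evp_u_eq0; rewrite rmorphB rmorphM !rmorphXn /=.
by rewrite evp_comp psi0_subXn -Dq exprMn subrr.
Qed.

Lemma deg_v : adjoin_degree E0 v = l.
Proof.
apply: (kummer_adjoin_degree l_pr kappa_prim) v_notin; first exact: kappa_base.
by rewrite -psi0_subXn psi0_E0.
Qed.

(** By [kummer_radical], w in F(u, v) would be c v^k with c in F(u). The l-th power of this
    identity, cleared of denominators, is excluded by [eps_poly_nradical]. *)
Lemma w_notin : w \notin E1.
Proof.
apply/negP => w_E1; have [||k [c cE0 def_w]] :=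
  kummer_radical l_pr kappa_prim (kappa_base z E0) _ v_notin w_E1.
- by rewrite -psi0_subXn psi0_E0.
- by rewrite -psi0_eps psi0_E0.
have [D [q [nzD Dq]]] := is_frac_E0 cE0.
have nzDX : D \Po 'X^l != 0.
  by apply: contraNneq nzD => D0; rewrite -e_eq0 -evp_comp D0 rmorph0.
case/negP: (eps_poly_nradical z_prim q k l_gt1 nzDX).
rewrite -subr_eq0; apply/eqP/evp_u_eq0; rewrite rmorphB !rmorphM !rmorphXn /=.
rewrite evp_comp psi0_subXn psi0_eps def_w -Dq !exprMn -!exprM [(k * l)%N]mulnC.
by rewrite mulrA subrr.
Qed.

Lemma psi1_E1 q : psi1 q \in E1.
Proof. by apply: evp_adjoin; apply: psi0_E0. Qed.

Lemma deg_w : adjoin_degree E1 w = l.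
Proof.
apply: (kummer_adjoin_degree l_pr kappa_prim) w_notin; first exact: kappa_base.
by rewrite -psi0_eps -(evpC _ v) psi1_E1.
Qed.

Definition ev1 (b d : F) : {rmorphism {poly {poly F}} -> F} := evp (evp idfun b) d.
Definition ev2 (b d c : F) : {rmorphism {poly {poly {poly F}}} -> F} := evp (ev1 b d) c.

(** The point (b, d, c) satisfies the equations of v and w, so [evp_ker] applies to w over F(u, v)
    and then to v over F(u); at the bottom u is transcendental. *)
Lemma ev_ker b d c : d ^+ l = 1 - b ^+ l -> c ^+ l = eps l z 0 b ->
  forall y, psi2 y = 0 -> ev2 b d c y = 0.
Proof.
move=> hd hc; apply: (evp_ker psi1_E1 (c := g%:P) l_gt0 deg_w).
- by rewrite -psi0_eps; apply/esym/evpC.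
- rewrite hc -horner_eps_poly; transitivity (evp idfun b g); last exact/esym/evpC.
  by rewrite evpE map_poly_id.
apply: (evp_ker psi0_E0 (c := 1 - 'X^l) l_gt0 deg_v).
- exact/esym/psi0_subXn.
- by rewrite hd rmorphB rmorph1 rmorphXn /= evpX.
by move=> q /evp_u_eq0 ->; rewrite rmorph0.
Qed.

Lemma is_frac_psi2 x : is_frac psi2 x.
Proof.
have tP D : psi1 (D \Po 'X^l)%:P = e D.
  by rewrite -evp_comp; apply: evpC.
have : x \in <<E1; w>>%VS.
  by rewrite (_ : <<E1; w>>%VS = fullv) ?memvf // -hR !adjoin_cons adjoin_nil agenv_id.
by apply: (is_frac_layer tP); apply: (is_frac_layer evp_comp); apply: is_frac_E0.
Qed.

(** * The integral closure and its subring F[u, v, w] *)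

Local Notation O := (intcl e).
Local Notation A := {poly {poly {poly F}}}.

Lemma u_integral : u \in intcl_pred e.
Proof. by apply/asboolP/(integral_exp l_gt0); rewrite hu; apply: integral_id. Qed.

Lemma v_integral : v \in intcl_pred e.
Proof. by apply/asboolP/(integral_exp l_gt0); rewrite hv; apply: integral_id. Qed.

Definition uO : O := exist _ u u_integral.

Lemma w_integral : w \in intcl_pred e.
Proof.
apply/asboolP/(integral_exp l_gt0); rewrite hw.
have /asboolP := valP (eps l (intcl_of e z%:P) 0 uO).
by rewrite rmorph_eps.
Qed.

Definition vO : O := exist _ v v_integral.
Definition wO : O := exist _ w w_integral.

Definition kappaO : F -> O := intcl_of e \o polyC.
HB.instance Definition _ := GRing.RMorphism.on kappaO.

(* O contains F[u, v, w] as the image of psi, the innermost variable being mapped to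
   u, the next one to v and the outermost one to w. *)
Definition psi : A -> O := evp (evp (evp kappaO uO) vO) wO.
HB.instance Definition _ := GRing.RMorphism.on psi.

Lemma val_psi y : val (psi y) = psi2 y.
Proof.
rewrite /psi; apply: (rmorph_evp (g := val)) => q.
by apply: (rmorph_evp (g := val)) => q'; apply: (rmorph_evp (g := val)).
Qed.

(** A lift of [intcl_of e] through [psi]; the substitution of X^l reflects t = u^l. *)
Definition tau : {poly F} -> A := polyC \o polyC \o comp_poly 'X^l.
HB.instance Definition _ := GRing.RMorphism.on tau.

Lemma psi2_C q : psi2 q%:P%:P = psi0 q.
Proof. by rewrite evpC; apply: evpC. Qed.

Lemma psi_tau D : psi (tau D) = intcl_of e D.
Proof. by apply: val_inj; rewrite val_psi psi2_C evp_comp. Qed.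

Lemma psi_ker b d c : d ^+ l = 1 - b ^+ l -> c ^+ l = eps l z 0 b ->
  forall y, psi y = 0 -> ev2 b d c y = 0.
Proof. by move=> hd hc y y0; apply: ev_ker => //; rewrite -val_psi y0. Qed.

Lemma intcl_frac (x : O) : exists D y, D != 0 /\ psi (tau D) * x = psi y.
Proof.
have [D [y [nzD def_y]]] := is_frac_psi2 (val x); exists D, y; split=> //.
by apply: val_inj; rewrite rmorphM /= !val_psi psi2_C evp_comp.
Qed.

Lemma psi_tau_reg D x : D != 0 -> psi (tau D) * x = 0 -> x = 0.
Proof.
move=> nzD; rewrite psi_tau => /(congr1 val); rewrite rmorphM => /eqP.
rewrite mulf_eq0 => /orP[D0 | /eqP x0]; last exact: val_inj.
by case/negP: nzD; rewrite -e_eq0.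
Qed.

Lemma intcl_integral (x : O) : exists n (c : nat -> A),
  x ^+ n = \sum_(i < n) psi (c i) * x ^+ i.
Proof.
have /asboolP[q q_monic /eqP q_root] := valP x; set n := (size q).-1.
have size_q : size q = n.+1 by rewrite prednK // size_poly_gt0 monic_neq0.
have q_n : e q`_n = 1.
  by transitivity (e 1); [congr (e _); apply: monicP | apply: rmorph1].
have x_root : \sum_(i < n) e q`_i * val x ^+ i + val x ^+ n = 0.
  rewrite -[RHS]q_root horner_coef size_map_poly_id0; last first.
    by rewrite [X in X != _](q_n : _ = 1) oner_neq0.
  rewrite size_q big_ord_recr coef_map; congr (_ + _).
    by apply: eq_bigr => i _; rewrite coef_map.
  by rewrite [X in X * _](q_n : _ = 1) mul1r.
(* The monic equation is solved for its top power, hence the sign. *)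
exists n, (fun i => tau (- q`_i)); apply: val_inj; rewrite rmorphXn rmorph_sum.
apply: (addrI (\sum_(i < n) e q`_i * val x ^+ i)); rewrite x_root -big_split.
rewrite big1 // => i _; rewrite psi_tau rmorphN.
by rewrite rmorphM rmorphN rmorphXn mulNr; apply: subrr.
Qed.

Definition iota2 : F -> {poly {poly F}} := polyC \o polyC.
HB.instance Definition _ := GRing.RMorphism.on iota2.

Definition iota3 : F -> A := polyC \o iota2.
HB.instance Definition _ := GRing.RMorphism.on iota3.

Lemma psi2_V : psi2 'X%:P = v.
Proof. by rewrite evpC; apply: evpX. Qed.

Lemma psi2_iota c : psi2 (iota3 c) = kappa c.
Proof. by rewrite /iota3 psi2_C; apply: evpC. Qed.

Lemma psi2_tau D : psi2 (tau D) = e D.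
Proof. by rewrite psi2_C; apply: evp_comp. Qed.

Local Notation U := ('X%:P%:P : A).
Local Notation V := ('X%:P : A).
Local Notation W := ('X : A).

Lemma tau_XsubC a : tau ('X - a%:P) = U ^+ l - iota3 a.
Proof.
by rewrite /tau /= comp_polyB comp_polyX comp_polyC !polyCB !rmorphXn.
Qed.

(** Both sides are a - t, since v^l = 1 - t. *)
Lemma psi_V_sub a : psi (V ^+ l - iota3 (1 - a)) = psi (-1 * tau ('X - a%:P)).
Proof.
apply: val_inj; rewrite mulN1r !val_psi rmorphB rmorphN rmorphXn /= psi2_V psi2_iota.
rewrite psi2_tau hv kappaE -(rmorphB e) -(rmorphN e); congr (e _).
by rewrite polyCB polyC1; ring.
Qed.

Section Congruences.
Variables (N : A -> Prop) (b d : F).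
Hypotheses (idN : ideal_pred N) (NU : N (U - iota3 b)) (NV : N (V - iota3 d)).

Let N1 h := N h%:P.
Let N0 h := N1 h%:P.

(** [evp_congr] is applied twice, first for U and then for V, to the restrictions of N to constant
    polynomials. *)
Lemma ideal_congr2 (q : {poly {poly F}}) : N (q - iota2 (ev1 b d q))%:P.
Proof.
have idN1 : ideal_pred N1 by apply: ideal_predC.
have idN0 : ideal_pred N0 by apply: ideal_predC.
have N00 c : N0 (c - c)%:P by rewrite subrr; case: idN0.
have N0X : N0 ('X - b%:P) by rewrite /N0 /N1 2!polyCB; exact: NU.
have N1C h : N1 (h - (evp idfun b h)%:P)%:P.
  exact: (@evp_congr F F idfun idfun N0 idN0 N00 b N0X h).
have N1X : N1 ('X - d%:P%:P) by rewrite /N1 polyCB.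
exact: (@evp_congr F {poly F} (evp idfun b) polyC N1 idN1 N1C d N1X q).
Qed.

Lemma ideal_congr_map y : N (y - map_poly iota2 (map_poly (ev1 b d) y)).
Proof. exact: (map_congr idN ideal_congr2). Qed.

Lemma ideal_congr3 c y : N (W - iota3 c) -> N (y - iota3 (ev2 b d c y)).
Proof. by move=> NW; apply: (evp_congr idN ideal_congr2 NW). Qed.

End Congruences.

(** * Traces of primes on F[u, v, w] *)

Section TowerPrime.
Variables (a b d : F) (m : A -> Prop).
Hypotheses (a0 : a != 0) (a1 : a != 1) (hb : b ^+ l = a) (hd : d ^+ l = 1 - a).
Hypotheses (m_prime : prime_pred m) (m_ker : forall y, psi y = 0 -> m y).
Hypotheses (mU : m (U - iota3 b)) (mV : m (V - iota3 d)).

Local Notation pi := (tau ('X - a%:P)).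
Local Notation princ := (princ psi pi m).

Let nz_l : l%:R != 0 :> F. Proof. exact: prim_root_natf_neq0 z_prim. Qed.
Let nz_b : b != 0.
Proof. by apply: contraNneq a0 => b0; rewrite -hb b0 expr0n gtn_eqF. Qed.
Let nz_d : d != 0.
Proof.
apply: contraNneq a1 => d0; move/eqP: hd.
by rewrite d0 expr0n gtn_eqF // eq_sym subr_eq0 eq_sym.
Qed.
Let idJ := princ_ideal psi pi m_prime.

Lemma princ_U : princ (U - iota3 b).
Proof.
apply: (princ_root m_prime nz_l nz_b mU (princ_pi psi pi m_prime)).
by rewrite hb tau_XsubC.
Qed.

Lemma princ_V : princ (V - iota3 d).
Proof.
have [_ _ JM] := idJ.
apply: (princ_root m_prime nz_l nz_d mV (JM (-1) _ (princ_pi psi pi m_prime))).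
by rewrite hd; apply: psi_V_sub.
Qed.

Lemma psi2_eps_sub x : psi2 (W ^+ l - iota3 x) = psi2 (g - x%:P)%:P%:P.
Proof.
rewrite psi2_C !rmorphB rmorphXn /= psi0_eps evpX; congr (_ - _).
by rewrite psi2_C.
Qed.

Lemma psi_eps_sub x : psi (W ^+ l - iota3 x) = psi (g - x%:P)%:P%:P.
Proof. by apply: val_inj; rewrite !val_psi psi2_eps_sub. Qed.

Lemma dvd_eps_sub (N : A -> Prop) : ideal_pred N -> N (U - iota3 b) ->
  N (g - (eps l z 0 b)%:P)%:P%:P.
Proof.
move=> [_ _ NM] NU; have /factor_theorem[q ->] : root (g - (eps l z 0 b)%:P) b.
  by rewrite rootE !hornerE horner_eps_poly subrr.
by rewrite !polyCM; apply: (NM); rewrite !polyCB.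
Qed.

Lemma m_eps : m (W ^+ l - iota3 (eps l z 0 b)).
Proof.
have [[m0 mD mM] _ _] := m_prime.
rewrite -[_ - _](subrK (g - (eps l z 0 b)%:P)%:P%:P); apply: (mD); last first.
  exact: dvd_eps_sub (And3 m0 mD mM) mU.
by apply/m_ker/eqP; rewrite rmorphB subr_eq0; apply/eqP/psi_eps_sub.
Qed.

Section Split.
Variable c : F.
Hypotheses (hc : c ^+ l = eps l z 0 b) (mW : m (W - iota3 c)).

(** Modulo m every y is congruent to the constant [ev2 b d c y], and m contains no nonzero
    constant. *)
Lemma prime_split y : m y <-> ev2 b d c y = 0.
Proof.
have [idm _ _] := m_prime; have my := ideal_congr3 idm mU mV y mW.
by rewrite (ideal_pred_sub idm my); apply: prime_pred_const.
Qed.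

(** By [princ_root] the differences U - b, V - d and W - c are locally divisible by pi, so y is
    congruent to its value 0 at the point modulo [princ]. That c is nonzero follows from b^l = a and
    a != 1. *)
Lemma princ_split y : m y -> princ y.
Proof.
have nz_c : c != 0.
  have := eps_neq0 z_prim (y := b); rewrite hb a1 -hc => /(_ isT).
  by apply: contraNneq => ->; rewrite expr0n gtn_eqF.
have JW : princ (W - iota3 c).
  apply: (princ_root m_prime nz_l nz_c mW (dvd_eps_sub idJ princ_U)).
  by rewrite hc; apply: psi_eps_sub.
move/prime_split => y0.
by rewrite -[y]subr0 -(rmorph0 iota3) -y0; apply: ideal_congr3 JW => //;
  [apply: princ_U | apply: princ_V].
Qed.

End Split.

Section Inert.
Hypothesis inert : forall x, x ^+ l != eps l z 0 b.

Local Notation q := ('X^l - (eps l z 0 b)%:P).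
Local Notation lift := (map_poly iota2).

Let liftq : lift q = W ^+ l - iota3 (eps l z 0 b).
Proof. by rewrite rmorphB /= map_polyXn map_polyC. Qed.

(** After U and V are replaced by b and d, m becomes an ideal of F[X] that contains the irreducible
    q but not 1. *)
Lemma prime_inert y : m y <-> q %| map_poly (ev1 b d) y.
Proof.
have [idm m1 _] := m_prime; have my := ideal_congr_map idm mU mV y.
rewrite (ideal_pred_sub idm my) {my}; move: (map_poly (ev1 b d) y) => h.
have [m0 mD mM] := idm; have mq : m (lift q) by rewrite liftq; apply: m_eps.
split=> [mh|/dvdpP[k ->]]; last by rewrite rmorphM; apply: (mM).
have [gcd1|gcdq] := irredp_XsubCP (irreducible_Xn_sub l_pr inert) (dvdp_gcdl q h).
  case: m1; rewrite gcdp_eqp1 in gcd1.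
  have /Bezout_eq1_coprimepP[[k1 k2] /= def1] := gcd1.
  by rewrite -(rmorph1 lift) -def1 rmorphD !rmorphM; apply: (mD); apply: (mM).
by rewrite -(eqp_dvdl _ gcdq) dvdp_gcdr.
Qed.

(** Modulo U - b and V - d, both locally divisible by pi, y becomes a multiple of W^l - g(b). This
    has the same image as g(U) - g(b), a multiple of U - b. *)
Lemma princ_inert y : m y -> princ y.
Proof.
move/prime_inert/dvdpP=> [k def_k].
have := ideal_congr_map idJ princ_U princ_V y; rewrite def_k.
have [J0 JD JM] := idJ => Jy.
rewrite -[y](subrK (lift (k * q))); apply: (JD) => //.
rewrite rmorphM /= liftq; apply: (JM).
apply: princ_psi (dvd_eps_sub idJ princ_U).
exact/esym/psi_eps_sub.
Qed.

End Inert.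
End TowerPrime.

(** * Counting the primes above X - a *)

Section PrimesAbove.
Variable a : F.
Hypotheses (a0 : a != 0) (a1 : a != 1).
Local Notation above := (primes_above e ('X - a%:P)).

Section Trace.
Variable P : O -> bool.
Hypothesis P_above : above P.

Lemma above_prime : prime_pred (fun y => psi y \in P).
Proof. by case: P_above => idP primeP _; apply: prime_pred_preim. Qed.

Lemma above_ker y : psi y = 0 -> psi y \in P.
Proof. by move=> ->; case: P_above => [[]]. Qed.

Lemma above_tau D : psi (tau D) \in P <-> D.[a] = 0.
Proof.
case: P_above => _ _ PE; rewrite psi_tau PE; split=> [[q ->]|/rootP/factor_theorem[q ->]].
  by rewrite !hornerE subrr mulr0.
by exists q.
Qed.

End Trace.

(** [integral_localised] writes x as y / s with s outside P, hence outside Q, so x lies in either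
    prime exactly when y does. *)
Lemma above_trace_inj P Q : above P -> above Q ->
  (forall y, psi y \in P -> princ psi (tau ('X - a%:P)) (fun y => psi y \in P) y) ->
  (forall y, psi y \in P <-> psi y \in Q) -> P = Q.
Proof.
move=> aP aQ Pprinc PQ; apply: funext => x.
have pi_reg y : psi (tau ('X - a%:P)) * y = 0 -> y = 0.
  by apply: psi_tau_reg; rewrite polyXsubC_eq0.
have [s [y [Ps def_y]]] := integral_localised (above_prime aP) (above_ker aP)
  (above_tau aP) Pprinc pi_reg intcl_frac intcl_integral x.
have mem_x (S : O -> bool) : above S -> ~ psi s \in S -> (x \in S <-> psi y \in S).
  move=> [idS primeS _] Ss; rewrite -def_y; split=> [Sx|].
    by have [_ _ SM] := idealr_pred idS; apply: SM.
  by case/primeS/orP.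
have Qs : ~ psi s \in Q by move/PQ.
have [Px xP] := mem_x P aP (fun H => Ps H); have [Qx xQ] := mem_x Q aQ Qs.
by apply/idP/idP => [/Px/PQ/xQ|/Qx/PQ/xP].
Qed.

Variables (b0 d0 : F).
Hypotheses (hb0 : b0 ^+ l = a) (hd0 : d0 ^+ l = 1 - a).

Let zb (i : 'I_l) := z ^+ i * b0.
Let zd (j : 'I_l) := z ^+ j * d0.

Let exp_zi (i : 'I_l) x : (z ^+ i * x) ^+ l = x ^+ l.
Proof. by rewrite exprMn exprAC (prim_expr_order z_prim) expr1n mul1r. Qed.

Let exp_neq0 (x : F) : x ^+ l != 0 -> x != 0.
Proof. by apply: contraNneq => ->; rewrite expr0n gtn_eqF. Qed.

Lemma above_roots P : above P -> exists i j : 'I_l,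
  psi (U - iota3 (zb i)) \in P /\ psi (V - iota3 (zd j)) \in P.
Proof.
move=> aP; have P_prime := above_prime aP.
have P_pi : psi (tau ('X - a%:P)) \in P by apply/(above_tau aP); rewrite !hornerE subrr.
have [i Pi] : exists i : 'I_l, psi (U - iota3 (zb i)) \in P.
  apply: (prime_root P_prime z_prim); first by apply: exp_neq0; rewrite hb0.
  by rewrite hb0 -tau_XsubC.
have [j Pj] : exists j : 'I_l, psi (V - iota3 (zd j)) \in P.
  apply: (prime_root P_prime z_prim).
    by apply: exp_neq0; rewrite hd0 subr_eq0 eq_sym.
  rewrite hd0 psi_V_sub; have [[_ _ PM] _ _] := P_prime; exact: PM.
by exists i, j.
Qed.

Section SplitPoint.
Variables b d c : F.
Hypotheses (hb : b ^+ l = a) (hd : d ^+ l = 1 - a) (hc : c ^+ l = eps l z 0 b).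

Lemma ev2_C q : ev2 b d c q%:P%:P = evp idfun b q.
Proof. exact: etrans (evpC _ _ _) (evpC _ _ _). Qed.

Lemma ev2_U : ev2 b d c U = b.
Proof. exact: etrans (ev2_C _) (evpX _ _). Qed.

Lemma ev2_V : ev2 b d c V = d.
Proof. exact: etrans (evpC _ _ _) (evpX _ _). Qed.

Lemma ev2_W : ev2 b d c W = c.
Proof. exact: evpX. Qed.

Lemma ev2_iota (x : F) : ev2 b d c (iota3 x) = x.
Proof. exact: etrans (ev2_C _) (evpC _ _ _). Qed.

Lemma ev2_sub y x : ev2 b d c (y - iota3 x) = ev2 b d c y - x.
Proof. by rewrite rmorphB ev2_iota. Qed.

Let ev2_ker y : psi y = 0 -> ev2 b d c y = 0.
Proof. by apply: psi_ker; rewrite ?hb. Qed.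

Lemma ev2_tau D : ev2 b d c (tau D) = D.[a].
Proof.
by rewrite ev2_C evpE map_poly_id // horner_comp hornerXn hb.
Qed.

Lemma ev2_localised x : exists s y, ev2 b d c s != 0 /\ psi s * x = psi y.
Proof.
have m_prime := prime_pred_ker (ev2 b d c).
have m_U : ev2 b d c (U - iota3 b) = 0 by rewrite ev2_sub ev2_U subrr.
have m_V : ev2 b d c (V - iota3 d) = 0 by rewrite ev2_sub ev2_V subrr.
have m_W : ev2 b d c (W - iota3 c) = 0 by rewrite ev2_sub ev2_W subrr.
have pi_reg y : psi (tau ('X - a%:P)) * y = 0 -> y = 0.
  by apply: psi_tau_reg; rewrite polyXsubC_eq0.
have m_tau D : ev2 b d c (tau D) = 0 <-> D.[a] = 0 by rewrite ev2_tau.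
have m_princ := princ_split a0 a1 hb hd m_prime m_U m_V hc m_W.
have [s [y [/eqP s0 sx]]] := integral_localised m_prime ev2_ker m_tau m_princ pi_reg
  intcl_frac intcl_integral x.
by exists s, y.
Qed.

Definition split_prime : O -> bool := point_ideal psi (ev2 b d c).

Lemma mem_split_prime y : psi y \in split_prime = (ev2 b d c y == 0).
Proof. exact: psi_point_ideal ev2_ker y. Qed.

Lemma split_prime_above : above split_prime.
Proof.
split; first exact: point_ideal_closed ev2_ker ev2_localised.
  exact: point_ideal_prime ev2_ker ev2_localised.
move=> D; rewrite -psi_tau mem_split_prime ev2_tau; split=> [|[q ->]].
  exact/factor_theorem.
by rewrite !hornerE subrr mulr0.
Qed.

Lemma above_eq_split P : above P -> psi (U - iota3 b) \in P ->
  psi (V - iota3 d) \in P -> psi (W - iota3 c) \in P -> P = split_prime.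
Proof.
move=> aP PU PV PW; have P_prime := above_prime aP.
apply: above_trace_inj => // [|y|y]; first exact: split_prime_above.
  exact: (princ_split a0 a1 hb hd P_prime PU PV hc PW).
rewrite mem_split_prime; apply: iff_trans (prime_split P_prime PU PV PW y) _.
exact: rwP eqP.
Qed.

End SplitPoint.

Lemma card_above_split : (forall i : 'I_l, exists c, c ^+ l = eps l z 0 (zb i)) ->
  (above #= `I_(l ^ 3))%card.
Proof.
move=> /fin_all_exists[c hc].
(* The third coordinate is an l-th root of g([zb i]), so its base root [c] depends on the first
   index. *)
pose point (t : 'I_l * 'I_l * 'I_l) :=
  split_prime (zb t.1.1) (zd t.1.2) (z ^+ t.2 * c t.1.1).
have hb i : zb i ^+ l = a by rewrite exp_zi.
have hd j : zd j ^+ l = 1 - a by rewrite exp_zi.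
have hzc i (k : 'I_l) : (z ^+ k * c i) ^+ l = eps l z 0 (zb i) by rewrite exp_zi.
have inj_z x : x != 0 -> injective (fun i : 'I_l => z ^+ i * x).
  move=> nzx i j /(mulIf nzx)/eqP; rewrite (eq_prim_root_expr z_prim) !modn_small //.
  by move/eqP/val_inj.
have nz_b0 : b0 != 0 by apply: exp_neq0; rewrite hb0.
have nz_d0 : d0 != 0 by apply: exp_neq0; rewrite hd0 subr_eq0 eq_sym.
have nz_c i : c i != 0.
  by apply: exp_neq0; rewrite hc (eps_neq0 z_prim) // hb.
suff above_bij : set_bij [set: 'I_l * 'I_l * 'I_l]%classic above point.
  have /card_esym : ([set: 'I_l * 'I_l * 'I_l] #= above)%card.
    by apply/card_set_bijP; exists point.
  have card_T : #|{: 'I_l * 'I_l * 'I_l}| = (l ^ 3)%N.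
    by rewrite !card_prod !card_ord -mulnA.
  by move/card_eq_trans; apply; rewrite -card_T; apply: card_setT_fin.
split=> [[[i j] k] _|[[i j] k] [[i' j'] k'] _ _ eq_pt|P aP].
- exact: (split_prime_above (hb i) (hd j) (hzc i k)).
- have mem_pt y : (ev2 (zb i) (zd j) (z ^+ k * c i) y == 0)
      = (ev2 (zb i') (zd j') (z ^+ k' * c i') y == 0).
    rewrite -(mem_split_prime (hb i) (hd j) (hzc i k)).
    by rewrite -(mem_split_prime (hb i') (hd j') (hzc i' k')) -/(point (i, j, k)) eq_pt.
  (* The coordinates are compared one at a time by testing the elements that vanish at the first
     point. The equality of i and i' is needed before W is tested, as c depends on i. *)
  have := mem_pt (U - iota3 (zb i)); rewrite !ev2_sub !ev2_U subrr eqxx.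
  move/esym; rewrite subr_eq0 => /eqP/(inj_z _ nz_b0) eq_i.
  have := mem_pt (V - iota3 (zd j)); rewrite !ev2_sub !ev2_V subrr eqxx.
  move/esym; rewrite subr_eq0 => /eqP/(inj_z _ nz_d0) eq_j.
  have := mem_pt (W - iota3 (z ^+ k * c i)); rewrite !ev2_sub !ev2_W subrr eqxx eq_i.
  move/esym; rewrite subr_eq0 => /eqP/(inj_z _ (nz_c i)) eq_k.
  by rewrite eq_j eq_k.
have [i [j [Pi Pj]]] := above_roots aP; have P_prime := above_prime aP.
have [k Pk] : exists k : 'I_l, psi (W - iota3 (z ^+ k * c i)) \in P.
  apply: (prime_root P_prime z_prim (nz_c i)); rewrite hc.
  exact: (m_eps P_prime (above_ker aP) Pi).
exists (i, j, k); first by [].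
by apply/esym; exact: (above_eq_split (hb i) (hd j) (hzc i k) aP Pi Pj Pk).
Qed.

(** Each prime is determined by its pair (i, j), because [prime_inert] describes the trace in terms
    of this pair alone. *)
Lemma card_above_inert : (forall (i : 'I_l) x, x ^+ l != eps l z 0 (zb i)) ->
  (above #<= `I_(l ^ 2))%card.
Proof.
move=> inert; pose rank (i j : 'I_l) : nat := enum_rank (i, j).
(* f numbers the pair (i, j) chosen for a prime; the value 0 off [above] is a default. *)
have /choice[f f_rank] : forall P : O -> bool, exists n, above P ->
    exists i j, [/\ n = rank i j, psi (U - iota3 (zb i)) \in P
      & psi (V - iota3 (zd j)) \in P].
  move=> P; have [aP|naP] := pselect (above P); last by exists 0%N.
  by have [i [j [Pi Pj]]] := above_roots aP; exists (rank i j) => _; exists i, j.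
apply/pcard_leP/injfunPex; exists f => [P aP|P Q /set_mem aP /set_mem aQ eq_f].
  have [i [j [-> _ _]]] := f_rank P aP; rewrite /rank /=.
  by rewrite -[X in (_ < X)%N]/(l * l)%N -[in X in (_ < X)%N](card_ord l) -card_prod.
have [i [j [fP Pi Pj]]] := f_rank P aP; have [i' [j' [fQ Qi Qj]]] := f_rank Q aQ.
have [eq_i eq_j] : i' = i /\ j' = j.
  by move: eq_f; rewrite fP fQ => /val_inj/enum_rank_inj[-> ->].
rewrite {}eq_i {}eq_j in Qi Qj.
have hb : zb i ^+ l = a by rewrite exp_zi.
have hd : zd j ^+ l = 1 - a by rewrite exp_zi.
have Pm := prime_inert (above_prime aP) (above_ker aP) Pi Pj (inert i).
have Qm := prime_inert (above_prime aQ) (above_ker aQ) Qi Qj (inert i).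
apply: (above_trace_inj aP aQ) => y.
  exact: (princ_inert a0 a1 hb hd (above_prime aP) (above_ker aP) Pi Pj (inert i)).
by rewrite Pm Qm.
Qed.

End PrimesAbove.

End Tower.

(** * The rational function field as base, and the criterion *)

Lemma poly_emb_eq0 (F : fieldType) (L : fieldExtType {fraction {poly F}}) D :
  (poly_emb L D == 0) = (D == 0).
Proof. by rewrite /poly_emb /= scaler_eq0 oner_eq0 orbF tofrac_eq0. Qed.

Lemma poly_emb_base (F : fieldType) (L : fieldExtType {fraction {poly F}}) D :
  poly_emb L D \in 1%VS.
Proof. by rewrite /poly_emb /= rpredZ ?mem1v. Qed.

Lemma poly_emb_frac (F : fieldType) (L : fieldExtType {fraction {poly F}}) (x : L) :
  x \in 1%VS -> exists D n, D != 0 /\ poly_emb L D * x = poly_emb L n.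
Proof.
case/vlineP => c ->; have [n [D [nzD def_c]]] := fraction_repr c.
by exists D, n; rewrite /poly_emb /= -def_c -scalerAl mul1r scalerA.
Qed.

Theorem theorem1p1 (l p : nat) (hl : prime l) (hl_odd : odd l)
  (hp : prime p) (hlp : (l %| p.-1)%N)
  (zeta : 'F_p) (hzeta : l.-primitive_root zeta)
  (R : fieldExtType {fraction {poly 'F_p}})
  (u v w : R)
  (hu : u ^+ l = poly_emb R 'X)
  (hv : v ^+ l = poly_emb R (1 - 'X))
  (hw : w ^+ l = eps l (poly_emb R zeta%:P) 0 u)
  (hR : <<1 & [:: u; v; w]>>%VS = fullv)
  (a : 'F_p) (ha0 : a != 0) (ha1 : a != 1)
  (ha : a ^+ (p.-1 %/ l) = 1) (h1a : (1 - a) ^+ (p.-1 %/ l) = 1) :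
  (primes_above (poly_emb R) ('X - a%:P) #= `I_(l ^ 3))%card
  <-> (A_poly l p zeta).[a] = 1.
Proof.
have exists_root := Fp_exp_root hp hl hlp.
have [b /eqP hb] : exists b, b ^+ l == a.
  by apply/existsP; rewrite -exists_root // ha.
have [d /eqP hd] : exists d, d ^+ l == 1 - a.
  by apply/existsP; rewrite -exists_root ?h1a // subr_eq0 eq_sym.
have zb_l (i : 'I_l) : (zeta ^+ i * b) ^+ l = a.
  by rewrite exprMn exprAC (prim_expr_order hzeta) expr1n mul1r.
have nz_eps (i : 'I_l) : eps l zeta 0 (zeta ^+ i * b) != 0.
  by rewrite (eps_neq0 hzeta) // zb_l.
have def_A (i : 'I_l) :
    (A_poly l p zeta).[a] = eps l zeta 0 (zeta ^+ i * b) ^+ (p.-1 %/ l).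
  by rewrite -{1}(zb_l i) (A_poly_exp hp hlp hzeta) ?zb_l.
(* The left side does not depend on i: either all the values of eps at the z^i b are l-th powers or
   none is. *)
have A_root (i : 'I_l) : ((A_poly l p zeta).[a] == 1)
    = [exists c, c ^+ l == eps l zeta 0 (zeta ^+ i * b)].
  by rewrite (def_A i) exists_root.
split=> [card_l3 | A1].
  apply/eqP; apply: contraT => A_neq1.
  have inert (i : 'I_l) x : x ^+ l != eps l zeta 0 (zeta ^+ i * b).
    by move: A_neq1; rewrite (A_root i) negb_exists => /forallP.
  have := card_above_inert hl hzeta (@poly_emb_eq0 _ R) (@poly_emb_frac _ R)
    hu hv hw hR ha0 ha1 hb hd inert.
  (* The inert case would give l^3 <= l^2. *)
  rewrite (card_le_eql card_l3) card_le_II leq_exp2l //; exact: prime_gt1.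
apply: (card_above_split hl hzeta (@poly_emb_eq0 _ R) (@poly_emb_base _ R)
  (@poly_emb_frac _ R) hu hv hw hR ha0 ha1 hb hd) => i.
by move/eqP: A1; rewrite (A_root i) => /existsP[c /eqP]; exists c.
Qed.
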